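(* Let $(G,O)$ be an equipped group with $G$ finite, i.e. $G$ is a finite group and $O\subset G$ is a subset invariant under inner automorphisms of $G$. Then the factorization semigroup of the unity $S_{O,\mathbf 1}=\{s\in S(G,O)\mid \alpha(s)=\mathbf 1\}$ is a finitely presented semigroup.
   Context: Factorization semigroup: for a group $G$ and a subset $O\subset G$ invariant under inner automorphisms (the pair $(G,O)$ is called an equipped group), $S(G,O)$ is the semigroup generated by letters $x_g$, $g\in O$, subject to the relations $x_{g_1}\cdot x_{g_2}=x_{g_2}\cdot x_{g_2^{-1}g_1g_2}$ and $x_{g_1}\cdot x_{g_2}=x_{g_1g_2g_1^{-1}}\cdot x_{g_1}$ for $g_1,g_2\in O$, where $x_{\mathbf 1}$ is identified with the unit (empty word) of the semigroup. The product homomorphism $\alpha:S(G,O)\to G$ is given by $\alpha(x_g)=g$. *)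

(* Defs.v *)
From HB Require Import structures.
From mathcomp Require Import all_boot all_fingroup.
From mathcomp Require Import boolp.

Set Implicit Arguments.
Unset Strict Implicit.
Unset Printing Implicit Defensive.

Local Open Scope group_scope.
Local Open Scope quotient_scope.

Section FreeMonoid.

Variable A : choiceType.

Definition free_monoid : Type := seq A.

HB.instance Definition _ := Choice.copy free_monoid (seq A).
HB.instance Definition _ :=
  isMonoid.Build free_monoid (@catA A) (@cat0s A) (@cats0 A).

Definition nonempty_word : pred free_monoid := fun w => w != 1.

Lemma nonempty_word_closed : mulg_closed nonempty_word.
Proof. by case=> [|x u]. Qed.

Definition free_semigroup : Type := {w : free_monoid | nonempty_word w}.

HB.instance Definition _ := SubChoice.on free_semigroup.
HB.instance Definition _ :=
  SubChoice_isSubSemigroup.Build free_monoid nonempty_word free_semigroup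
    nonempty_word_closed.

End FreeMonoid.

Inductive congruence_closure (M : semigroupType) (R : M -> M -> Prop) :
    M -> M -> Prop :=
| cong_base x y : R x y -> congruence_closure R x y
| cong_refl x : congruence_closure R x x
| cong_sym x y : congruence_closure R x y -> congruence_closure R y x
| cong_trans x y z : congruence_closure R x y -> congruence_closure R y z ->
    congruence_closure R x z
| cong_mul x x' y y' : congruence_closure R x x' ->
    congruence_closure R y y' -> congruence_closure R (x * y) (x' * y').

Section Presented.

Variables (M : semigroupType) (R : M -> M -> Prop).

Definition cong_rel : rel M := fun x y => `[< congruence_closure R x y >].

Lemma cong_rel_refl : reflexive cong_rel.
Proof. by move=> x; apply/asboolP/cong_refl. Qed.

Lemma cong_rel_sym : symmetric cong_rel.
Proof. by move=> x y; apply/asboolP/asboolP; apply: cong_sym. Qed.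

Lemma cong_rel_trans : transitive cong_rel.
Proof.
move=> y x z /asboolP xy /asboolP yz; apply/asboolP; exact: cong_trans xy yz.
Qed.

Canonical cong_equiv := EquivRel cong_rel cong_rel_refl cong_rel_sym cong_rel_trans.

(* The quotient of M by the smallest congruence containing R; for M free on A,
   this is the semigroup (or monoid) presented by < A | R >. *)
Definition presented : Type := {eq_quot cong_equiv}.

HB.instance Definition _ := Choice.on presented.
HB.instance Definition _ := EqQuotient.on presented.

Lemma presented_eqP x y :
  reflect (congruence_closure R x y) (\pi_presented x == \pi_presented y).
Proof. by rewrite piE; apply: asboolP. Qed.

Definition presented_mul : presented -> presented -> presented :=
  fun x y => \pi_presented (generic_quotient.repr x * generic_quotient.repr y).

Lemma pi_mul : {morph \pi_presented : x y / x * y >-> presented_mul x y}.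
Proof.
move=> x y; apply/eqP/presented_eqP/cong_mul; apply/presented_eqP;
by rewrite reprK.
Qed.

Lemma presented_mulA : associative presented_mul.
Proof.
move=> x y z; rewrite -[x]reprK -[y]reprK -[z]reprK.
move: (generic_quotient.repr x) (generic_quotient.repr y) (generic_quotient.repr z).
move=> a b c; rewrite -(pi_mul b c) -(pi_mul a b).
by rewrite -(pi_mul a (b * c)) -(pi_mul (a * b) c) mulgA.
Qed.

HB.instance Definition _ := isSemigroup.Build presented presented_mulA.

End Presented.

Section PresentedMonoid.

Variables (M : monoidType) (R : M -> M -> Prop).

Let one : presented R := \pi_(presented R) 1.

Lemma presented_mul1 : left_id one (@mul (presented R)).
Proof. by move=> x; rewrite -[x]reprK -[LHS]pi_mul mul1g. Qed.

Lemma presented_mulr1 : right_id one (@mul (presented R)).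
Proof. by move=> x; rewrite -[x]reprK -[LHS]pi_mul mulg1. Qed.

HB.instance Definition _ :=
  Magma_isUMagma.Build (presented R) presented_mul1 presented_mulr1.

End PresentedMonoid.

(* Presentations are taken in the category of semigroups: words are nonempty, so
   the unit of S, if any, has to be a product of generators. *)
Definition finitely_presented (S : semigroupType) : Prop :=
  exists (n : nat) (r : seq (free_semigroup 'I_n * free_semigroup 'I_n)),
  exists f : {multiplicative presented (fun u v => (u, v) \in r) -> S},
    bijective f.

Section FactorizationSemigroup.

Variables (gT : finGroupType) (O : {set gT}).

Definition letter : Type := {g : gT | g \in O}.
HB.instance Definition _ := SubFinite.on letter.

(* The conjugated letter h is determined by its value, and it exists as soon as
   O is invariant under conjugation. *)
Inductive factorization_relation : free_monoid letter -> free_monoid letter -> Prop :=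
| fact_rel_right (g1 g2 h : letter) : val h = val g1 ^ val g2 ->
    factorization_relation [:: g1; g2] [:: g2; h]
| fact_rel_left (g1 g2 h : letter) : val h = val g1 * val g2 * (val g1)^-1 ->
    factorization_relation [:: g1; g2] [:: h; g1]
| fact_rel_unit (g : letter) : val g = 1 -> factorization_relation [:: g] [::].

Definition factorization_semigroup : Type := presented factorization_relation.
HB.instance Definition _ := Monoid.on factorization_semigroup.

Definition word_product (w : free_monoid letter) : gT := \prod_(g <- w) val g.

Lemma word_productM (u v : free_monoid letter) :
  word_product (u * v) = word_product u * word_product v.
Proof. by rewrite /word_product big_cat. Qed.

Lemma word_product_cong (u v : free_monoid letter) :
  congruence_closure factorization_relation u v ->
  word_product u = word_product v.
Proof.
elim=> {u v} [u v|//|//|u v w _ -> //|u u' v v' _ eu _ ev].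
- case=> [g1 g2 h eh|g1 g2 h eh|g eg]; rewrite /word_product !big_cons ?big_nil.
  + by rewrite eh !mulg1 -conjgC.
  + by rewrite eh !mulg1 mulgKV.
  + by rewrite eg mulg1.
- by rewrite !word_productM eu ev.
Qed.

Definition product_hom (s : factorization_semigroup) : gT :=
  word_product (generic_quotient.repr s).

Lemma product_hom_pi (w : free_monoid letter) :
  product_hom (\pi_(presented factorization_relation) w) = word_product w.
Proof. by apply/word_product_cong/presented_eqP; rewrite reprK. Qed.

Lemma product_hom_letter (g : letter) :
  product_hom (\pi_(presented factorization_relation) [:: g]) = val g.
Proof. by rewrite product_hom_pi /word_product big_seq1. Qed.

Lemma product_hom_morphism : monoid_morphism product_hom.
Proof.
split; first by rewrite [LHS]product_hom_pi /word_product big_nil.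
move=> s t; rewrite -[s](reprK (s : presented _)) -[t](reprK (t : presented _)).
by rewrite -[_ * _ in LHS]pi_mul !product_hom_pi word_productM.
Qed.

HB.instance Definition _ :=
  isUMagmaMorphism.Build factorization_semigroup gT product_hom
    product_hom_morphism.

Definition factors_unity : pred factorization_semigroup :=
  fun s => product_hom s == 1.

Lemma factors_unity_closed : umagma_closed factors_unity.
Proof.
have [h1 hM] := product_hom_morphism.
split; first by rewrite unfold_in /factors_unity h1.
by move=> s t /eqP es /eqP et; rewrite unfold_in /factors_unity hM es et mulg1.
Qed.

Definition unity_factorizations : Type :=
  {s : factorization_semigroup | factors_unity s}.

HB.instance Definition _ := SubChoice.on unity_factorizations.
HB.instance Definition _ :=
  SubChoice_isSubMonoid.Build factorization_semigroup factors_unity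
    unity_factorizations factors_unity_closed.

End FactorizationSemigroup.

(* Main.v *)
(** The relations move a letter [x_g] past a word [v] at the cost of conjugating
    [g] by the product of [v]; so words of product 1 are central, and the
    semigroup of factorizations of unity is commutative.  A word longer than
    [|G|] has two equal prefix products, hence a nonempty subword of product 1
    and length at most [|G|], which can be pulled out by centrality: the
    semigroup is generated by the words of length at most [|G|].  A finitely
    generated commutative semigroup is finitely presented (Rédei). *)

Require Import Defs.
From HB Require Import structures.
From mathcomp Require Import all_boot all_fingroup.
From mathcomp Require Import boolp.

Local Open Scope group_scope.

(** * Lexicographic comparison of exponent vectors, and Dickson's lemma *)

Section LexicographicOrder.

Variables (A : eqType) (T : Type) (c : A -> T -> nat).

Fixpoint lex_lt (s : seq A) (u v : T) : bool :=
  if s is a :: s' then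
    (c a u < c a v) || ((c a u == c a v) && lex_lt s' u v)
  else false.

(** Minimise the first coordinate over [P], then recurse on the elements of [P] that attain this
    minimum. *)
Lemma lex_minimum (s : seq A) (P : T -> Prop) :
  (exists u, P u) -> exists2 u, P u & forall v, P v -> ~~ lex_lt s v u.
Proof.
elim: s P => [|a s IHs] P [u Pu]; first by exists u.
have exn : exists n, `[< exists2 v, P v & c a v = n >].
  by exists (c a u); apply/asboolP; exists u.
case: (ex_minnP exn) => n /asboolP[v Pv cv] n_min.
have [|w [Pw cw] w_min] := IHs (fun w => P w /\ c a w = n); first by exists v.
exists w => // x Px; rewrite /= cw negb_or -leqNgt n_min /=; last first.
  by apply/asboolP; exists x.
by case: eqP => //= cx; apply: w_min.
Qed.

Lemma lex_total (s : seq A) (u v : T) :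
  ~~ lex_lt s u v -> ~~ lex_lt s v u -> {in s, forall a, c a u = c a v}.
Proof.
elim: s => //= a s IHs; rewrite !negb_or -!leqNgt (eq_sym (c a v)).
move=> /andP[le1 +] /andP[le2]; have/eqP eq_uv : c a u == c a v.
  by rewrite eqn_leq le1 le2.
rewrite eq_uv eqxx => /= nlt1 nlt2 b; rewrite inE => /predU1P[-> //|].
exact: IHs.
Qed.

(** Compatibility with adding an exponent vector [d]: replacing a factor of a word by a smaller one
    makes the word smaller. *)
Lemma lex_lt_translate (s : seq A) (u v u' v' : T) (d : A -> nat) :
  (forall a, c a u' = c a u + d a) -> (forall a, c a v' = c a v + d a) ->
  lex_lt s u v -> lex_lt s u' v'.
Proof.
move=> du dv; elim: s => //= a s IHs.
rewrite du dv ltn_add2r eqn_add2r => /orP[-> //|/andP[-> /IHs->]].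
by rewrite orbT.
Qed.

End LexicographicOrder.

(** Induction on the coordinates. A basis [B] for the remaining coordinates dominates every [u]
    whose first coordinate is at least the maximum [K] over [B]; the other elements lie in [K]
    slices of constant first coordinate, each with a finite basis. *)
Lemma dickson (A T : eqType) (c : A -> T -> nat) (s : seq A) (P : T -> Prop) :
  exists2 B : seq T, {in B, forall b, P b} &
    forall u, P u -> exists2 b, b \in B & {in s, forall a, c a b <= c a u}.
Proof.
elim: s P => [|a s IHs] P.
  have [[b Pb]|nP] := pselect (exists b, P b).
    by exists [:: b] => [x /[!inE]/eqP-> //|u _]; exists b; rewrite ?inE.
  by exists [::] => // u Pu; case: nP; exists u.
have [B PB domB] := IHs P.
have exD n : exists D : seq T, {in D, forall b, P b /\ c a b = n} /\
    forall u, P u /\ c a u = n ->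
      exists2 b, b \in D & {in s, forall a, c a b <= c a u}.
  by have [D PD domD] := IHs (fun u => P u /\ c a u = n); exists D.
have [D /all_and2[PD domD]] := choice exD.
pose K := \max_(b <- B) c a b.
exists (B ++ flatten [seq D n | n <- iota 0 K]).
  move=> b; rewrite mem_cat => /orP[/PB //|/flatten_mapP[n _ /PD[]//]].
move=> u Pu; have [leKu|ltuK] := leqP K (c a u).
  have [b Bb le_bu] := domB u Pu.
  exists b => [|x]; first by rewrite mem_cat Bb.
  rewrite inE => /predU1P[->|/le_bu//].
  by apply: leq_trans leKu; apply: leq_bigmax_seq.
have [b Db le_bu] := domD _ u (conj Pu erefl).
exists b => [|x].
  rewrite mem_cat; apply/orP; right; apply/flatten_mapP.
  by exists (c a u); rewrite ?mem_iota.
by rewrite inE => /predU1P[->|/le_bu//]; have [_ ->] := PD _ _ Db.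
Qed.

(** * Congruences on words *)

Section Words.

Variable A : choiceType.

Lemma cong_cat (R : free_monoid A -> free_monoid A -> Prop)
    (u u' v v' : seq A) :
  congruence_closure R u u' -> congruence_closure R v v' ->
  congruence_closure R (u ++ v) (u' ++ v').
Proof. exact: (@cong_mul (free_monoid A)). Qed.

Lemma cong_catC (R : free_monoid A -> free_monoid A -> Prop) (v : seq A) :
  (forall a, congruence_closure R (a :: v) (rcons v a)) ->
  forall u : seq A, congruence_closure R (u ++ v) (v ++ u).
Proof.
move=> comm_v; elim=> [|a u IHu]; first by rewrite cats0; apply: cong_refl.
apply: (@cong_trans (free_monoid A) _ _ ([:: a] ++ (v ++ u))).
  exact: (cong_cat R [:: a] [:: a] _ _ (cong_refl _ _)).
by rewrite -cat_rcons catA; apply: cong_cat; [exact: comm_v|exact: cong_refl].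
Qed.

Lemma cong_perm (R : free_monoid A -> free_monoid A -> Prop) :
  (forall a b : A, congruence_closure R [:: a; b] [:: b; a]) ->
  forall u v : seq A, perm_eq u v -> congruence_closure R u v.
Proof.
move=> commR u v uv.
have comm1 (w : seq A) a : congruence_closure R (a :: w) (rcons w a).
  rewrite -cats1; apply: cong_sym; apply: (cong_catC R [:: a]) => b.
  exact: commR.
(* Exchanges of adjacent blocks generate all permutations. *)
apply: (catCA_perm_ind (P := congruence_closure R u) _ uv); last exact: cong_refl.
move=> s1 s2 s3 h; apply: cong_trans h _; rewrite !catA.
by apply: cong_cat; [apply: cong_catC|apply: cong_refl].
Qed.

Variable R : free_semigroup A -> free_semigroup A -> Prop.

Definition word_relation (u v : free_monoid A) : Prop :=
  exists U V, [/\ R U V, u = val U & v = val V].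

(* Contexts around a rewritten subword may be empty, hence the detour through
   the free monoid. *)
Lemma word_relation_cong (U V : free_semigroup A) :
  congruence_closure word_relation (val U) (val V) -> congruence_closure R U V.
Proof.
(* No relation involves the empty word, so congruent words are both empty or both nonempty; the
   middle word of a transitivity step therefore lifts to the free semigroup. *)
suff gen u v : congruence_closure word_relation u v ->
    nonempty_word u = nonempty_word v /\ forall U V : free_semigroup A,
      val U = u -> val V = v -> congruence_closure R U V.
  by move=> /gen[_]; apply.
elim=> {U V u v}.
- move=> _ _ [U [V [RUV -> ->]]]; split; first by rewrite (valP U) (valP V).
  by move=> ? ? /val_inj-> /val_inj->; apply: cong_base.
- by move=> u; split=> // U V <- /val_inj->; apply: cong_refl.
- move=> u v _ [-> IH]; split=> // U V eU eV; apply: cong_sym; exact: IH.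
- move=> u v w _ [-> IH1] _ [e2 IH2]; split=> // U W eU eW.
  have nv : nonempty_word v by rewrite e2 -eW (valP W).
  exact: cong_trans (IH1 U (Sub v nv) eU erefl) (IH2 (Sub v nv) W erefl eW).
- move=> u u' v v' _ [eu IHu] _ [ev IHv]; split.
    case: u u' v v' eu ev {IHu IHv} => [|? ?] [|? ?] [|? ?] [|? ?] //.
  move=> U V; case: (boolP (nonempty_word u)) eu => nu /esym eu; last first.
    move: nu eu; rewrite /nonempty_word => /negPn/eqP-> /negbFE/eqP->.
    by rewrite !mul1g; apply: IHv.
  case: (boolP (nonempty_word v)) ev => nv /esym ev; last first.
    move: nv ev; rewrite /nonempty_word => /negPn/eqP-> /negbFE/eqP->.
    by rewrite !mulg1; apply: IHu.
  move=> eU eV.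
  have -> : U = (Sub u nu : free_semigroup A) * Sub v nv by apply: val_inj.
  have -> : V = (Sub u' eu : free_semigroup A) * Sub v' ev by apply: val_inj.
  by apply: cong_mul; [apply: IHu|apply: IHv].
Qed.

Definition word1 (a : A) : free_semigroup A := Sub [:: a] isT.

End Words.
Arguments word1 {A} a.

(** * Finitely generated commutative semigroups are finitely presented *)

Lemma mult_cong (M S : semigroupType) (R : M -> M -> Prop)
    (e : {multiplicative M -> S}) :
  (forall u v, R u v -> e u = e v) ->
  forall u v, congruence_closure R u v -> e u = e v.
Proof.
move=> eR u v; elim=> {u v} [u v /eR //|//|//|u v w _ -> _ -> //|].
by move=> u u' v v' _ eu _ ev; rewrite !gmulfM eu ev.
Qed.

(* Rédei's theorem, by a Gröbner basis argument: the words that are not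
   lexicographically minimal in their fibre form an ideal of N^n, finitely
   generated by Dickson's lemma; rewriting each generator to a smaller word of
   its fibre brings every word to the minimum of its fibre. *)
Theorem redei (n : nat) (S : semigroupType) (mulC : commutative (@mul S))
    (e : {multiplicative free_semigroup 'I_n -> S})
    (esurj : forall x, exists u, e u = x) :
  finitely_presented S.
Proof.
set W := free_semigroup 'I_n.
pose c (i : 'I_n) (u : W) := count_mem i (val u : seq 'I_n).
pose lt := lex_lt _ _ c (enum 'I_n).
pose reducible (u : W) := exists2 v : W, e v = e u & lt v u.
have [B redB domB] := dickson _ _ c (enum 'I_n) reducible.
(* The implication lets [choice] give a total function [m]; its values on irreducible words are
   arbitrary. *)
have exm u : exists v : W, reducible u -> e v = e u /\ lt v u.
  have [[v]|nr] := pselect (reducible u); first by exists v.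
  by exists u => /nr.
have [m mP] := choice exm.
pose r := [seq (word1 i * word1 j, word1 j * word1 i)
             | i <- enum 'I_n, j <- enum 'I_n]
          ++ [seq (b, m b) | b <- B].
pose R (u v : W) : Prop := (u, v) \in r.
have eR u v : congruence_closure R u v -> e u = e v.
  apply: mult_cong => {}u {}v; rewrite /R mem_cat => /orP[].
    by case/allpairsP=> [[i j] [_ _ [-> ->]]]; rewrite !gmulfM mulC.
  by case/mapP=> b /redB/mP[emb _] [-> ->].
have Rperm (u v : seq 'I_n) : perm_eq u v ->
    congruence_closure (word_relation _ R) u v.
  apply: cong_perm => i j; apply: cong_base.
  exists (word1 i * word1 j), (word1 j * word1 i).
  split=> //; rewrite /R mem_cat; apply/orP; left.
  by apply/allpairsP; exists (i, j); rewrite !mem_enum.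
(* Take [v] lexicographically minimal in the class of [u]. Were it reducible, it would be a
   permutation of [b ++ w] with [b] in [B], and [m b ++ w] would be a smaller word of the same
   class. *)
have Rnorm u : exists2 v, congruence_closure R u v & ~ reducible v.
  have [|v Ruv v_min] := lex_minimum _ _ c (enum 'I_n) (congruence_closure R u).
    by exists u; apply: cong_refl.
  exists v => // /domB[b Bb le_bv].
  have/count_subseqP[b' /perm_to_subseq[w vb'w] bb'] :
      forall i, count_mem i (val b : seq 'I_n) <= count_mem i (val v : seq 'I_n).
    by move=> i; apply: le_bv; rewrite mem_enum.
  have vbw : perm_eq (val v : seq 'I_n) ((val b : seq 'I_n) ++ w).
    by apply: perm_trans vb'w _; rewrite perm_cat2r perm_sym.
  have [emb lt_mb] := mP b (redB b Bb).
  have nv' : nonempty_word ((val (m b) : seq 'I_n) ++ w).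
    by case: (m b) => -[].
  pose v' : W := Sub _ nv'.
  suff Rvv' : congruence_closure R v v'.
    have/negP[] := v_min v' (cong_trans Ruv Rvv').
    apply: lex_lt_translate lt_mb => i; first exact: count_cat.
    by rewrite /c (seq.permP vbw) count_cat.
  apply: word_relation_cong.
  apply: (@cong_trans (free_monoid 'I_n) _ _ ((val b : seq 'I_n) ++ w)).
    exact: Rperm.
  apply: cong_cat; last exact: cong_refl.
  apply: cong_base; exists b, (m b); split=> //.
  by rewrite /R mem_cat (map_f (fun b => (b, m b))) ?orbT.
(* Of two irreducible words in one fibre neither is smaller, so their letter counts agree and they
   are permutations of each other. *)
have Rcomplete u v : e u = e v -> congruence_closure R u v.
  move=> euv; have [u' Ruu' u'_irr] := Rnorm u; have [v' Rvv' v'_irr] := Rnorm v.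
  have eu'v' : e u' = e v' by rewrite -(eR _ _ Ruu') -(eR _ _ Rvv').
  apply: cong_trans Ruu' (cong_trans _ (cong_sym Rvv')).
  apply/word_relation_cong/Rperm/allP => i _ /=; apply/eqP.
  apply: (lex_total _ _ c (enum 'I_n)); rewrite ?mem_enum //.
    by apply/negP=> ltuv; apply: v'_irr; exists u'.
  by apply/negP=> ltvu; apply: u'_irr; exists v'.
exists n, r.
pose f (x : presented R) : S := e (generic_quotient.repr x).
have f_pi u : f (\pi_(presented R) u)%qT = e u.
  by apply/eR/presented_eqP; rewrite reprK.
have fM : {morph f : x y / x * y} by move=> x y; rewrite [LHS]f_pi gmulfM.
pose fMul := isMultiplicative.Build _ _ f fM.
pose F : {multiplicative presented R -> S} := HB.pack f fMul.
exists F; have [g gP] := choice esurj.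
exists (fun x => (\pi_(presented R) (g x))%qT) => x; last first.
  by rewrite [LHS]f_pi gP.
rewrite -[RHS]reprK; apply/eqP/presented_eqP/Rcomplete; exact: gP.
Qed.

(** * Factorizations of unity: centrality and finite generation *)

Section UnityFactorizations.

Variables (gT : finGroupType) (G : {group gT}) (O : {set gT}).
Hypotheses (OG : O \subset G) (Oinv : {in O & G, forall x g, x ^ g \in O}).

Local Notation word := (seq (letter O)).
Local Notation cong := (congruence_closure (factorization_relation (O := O))).
Local Notation quo := (\pi_(presented (factorization_relation (O := O))))%qT.

Lemma letter_past_word (v : word) (g h : letter O) :
  val h = val g ^ word_product v -> cong (g :: v) (rcons v h).
Proof.
elim: v g => [|a v IHv] g.
  by rewrite /word_product big_nil conjg1 => /val_inj->; apply: cong_refl.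
have Oga : val g ^ val a \in O.
  by rewrite Oinv ?(valP g) // (subsetP OG) // (valP a).
rewrite /word_product big_cons conjgM => eh.
pose g' : letter O := Sub (val g ^ val a) Oga.
apply: (@cong_trans (free_monoid (letter O)) _ _ ([:: a; g'] ++ v)).
  apply: (cong_cat _ _ [:: g; a] _ v); last exact: cong_refl.
  exact/cong_base/fact_rel_right.
by apply: (cong_cat _ _ [:: a] [:: a]); [apply: cong_refl|apply: IHv].
Qed.

Lemma unity_word_central (v : word) :
  word_product v = 1 -> forall u : word, cong (u ++ v) (v ++ u).
Proof.
move=> v1; apply: cong_catC => g; apply: letter_past_word.
by rewrite v1 conjg1.
Qed.

Lemma unity_subword (w : word) : #|gT| < size w ->
  exists u v z : word, [/\ w = u ++ v ++ z, 0 < size v <= #|gT|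
                         & word_product v = 1].
Proof.
move=> ltw.
(* Pigeonhole on the [#|gT|.+1] prefixes of length at most [#|gT|]; this restriction on lengths also
   bounds the subword between two of them. *)
pose p (i : 'I_#|gT|.+1) := word_product (take i w).
have/injectivePn[i [j neq_ij eq_p]] : ~~ injectiveb p.
  apply/negP=> /injectiveP/leq_card; rewrite card_ord.
  by rewrite ltnn.
wlog lt_ij : i j neq_ij eq_p / i < j.
  move=> wl; case: (ltngtP i j) => [|ltji|/val_inj eq_ij]; first exact: wl.
    by apply: (wl j i) => //; rewrite eq_sym.
  by rewrite eq_ij eqxx in neq_ij.
have le_jn : j <= #|gT| by rewrite -ltnS ltn_ord.
pose v := take (j - i) (drop i w).
have take_j : take j w = take i w ++ v.
  by rewrite -takeD subnKC // ltnW.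
exists (take i w), v, (drop j w); split.
- by rewrite catA -take_j cat_take_drop.
- rewrite size_takel ?subn_gt0 ?lt_ij.
    exact: leq_trans (leq_subr _ _) le_jn.
  by rewrite size_drop leq_sub2r // (leq_trans le_jn) // ltnW.
- apply: (mulgI (word_product (take i w))).
  by rewrite mulg1 -[LHS]word_productM -[RHS]/(p i) eq_p /p take_j.
Qed.

(** The default value 1 makes this total, so that all bounded words, whatever their product, can
    index the generators. *)
Definition unity_elt (w : word) : unity_factorizations O := insubd 1 (quo w).

Lemma val_unity_elt (w : word) :
  word_product w = 1 -> val (unity_elt w) = quo w.
Proof.
move=> w1; rewrite insubdK //.
by rewrite unfold_in /factors_unity product_hom_pi w1.
Qed.

Lemma unity_elt_generators (w : word) : word_product w = 1 ->
  exists s : seq {bseq #|gT| of letter O},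
    unity_elt w = \prod_(v <- s) unity_elt v.
Proof.
have [m] := ubnP (size w); elim: m w => // m IHm w; rewrite ltnS => lewm w1.
have [lew|/unity_subword[u [v [z [ew /andP[v_gt0 lev] v1]]]]] :=
    leqP (size w) #|gT|.
  by exists [:: Bseq lew]; rewrite big_seq1.
have uz1 : word_product (u ++ z) = 1.
  rewrite -w1 ew [LHS]word_productM !(word_productM _ (_ ++ _)).
  by rewrite [in RHS]word_productM v1 mul1g.
have [|s es] := IHm (u ++ z) _ uz1.
  apply: leq_trans lewm; rewrite ew !size_cat ltn_add2l -add1n.
  by rewrite -[X in _ <= X]/(size v + size z) leq_add2r.
exists (Bseq lev :: s); rewrite big_cons -es; apply: val_inj.
rewrite [RHS]valM !val_unity_elt // -[RHS]pi_mul.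
(* The central subword [v] moves to the front, past [u]. *)
apply/eqP/presented_eqP; rewrite ew [u ++ _]catA [_ * _]catA.
by apply: cong_cat; [apply: unity_word_central|apply: cong_refl].
Qed.

Lemma unity_mulC : commutative (@mul (unity_factorizations O)).
Proof.
move=> x y; apply: val_inj; rewrite !valM.
have y1 : word_product (generic_quotient.repr (val y)) = 1.
  exact/eqP/(valP y).
rewrite -[val x](reprK (val x : presented _)).
rewrite -[val y](reprK (val y : presented _)).
rewrite -[LHS]pi_mul -[RHS]pi_mul.
exact/eqP/presented_eqP/unity_word_central.
Qed.

End UnityFactorizations.

(** * Evaluation of words in the generators, and conclusion *)

Section Evaluation.

Variables (A : choiceType) (S : monoidType) (g : A -> S).

Definition eval_word (w : free_semigroup A) : S :=
  \prod_(a <- (val w : seq A)) g a.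

Lemma eval_wordM : {morph eval_word : u v / u * v}.
Proof. by move=> u v; rewrite /eval_word -big_cat. Qed.

HB.instance Definition _ :=
  isMultiplicative.Build (free_semigroup A) S eval_word eval_wordM.

End Evaluation.

Theorem theorem1p1 (gT : finGroupType) (G : {group gT}) (O : {set gT})
    (OG : O \subset G) (Oinv : {in O & G, forall x g, x ^ g \in O}) :
  finitely_presented (unity_factorizations O).
Proof.
pose B := {bseq #|gT| of letter O}.
pose g (i : 'I_#|B|) := unity_elt _ O (enum_val i).
apply: (redei #|B| _ (unity_mulC _ _ _ OG Oinv) (eval_word _ _ g)) => x.
pose w : seq (letter O) := generic_quotient.repr (val x).
have w1 : word_product w = 1.
  by have/eqP := valP x.
have [s es] := unity_elt_generators _ _ _ OG Oinv w w1.
have ex : unity_elt _ _ w = x.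
  by apply: val_inj; rewrite val_unity_elt // reprK.
(* The empty word is itself a generator, and makes the word below nonempty. *)
pose t := [seq enum_rank b | b <- ([bseq] : B) :: s].
exists (Sub t isT); rewrite -ex es.
rewrite -[LHS]/(\prod_(i <- t) g i) big_map big_cons.
rewrite /g enum_rankK.
have -> : unity_elt gT O ([bseq] : B) = 1.
  by apply: val_inj; rewrite val_unity_elt // /word_product big_nil.
by rewrite mul1g; apply: eq_bigr => b _; rewrite enum_rankK.
Qed.
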